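(* Let $0<q<1$. The kernel of the map $Z=\triangleleft(F_2F_1,F_2)$ restricted to $L^2(\mathbb CP^2_q)$ is $\mathbb C$ (the scalar multiples of the unit); that is, $\{a\in L^2(\mathbb CP^2_q)\cap\mathrm{Dom}(Z):Z(a)=0\}=\mathbb C$.
   Context: Fix $0<q<1$. $U_q(\mathfrak{su}(3))$ is the Hopf $*$-algebra generated by $K_i^{\pm1},E_i,F_i$ ($i=1,2$), $K_i^*=K_i$, $E_i^*=F_i$, with $[K_1,K_2]=0$, $K_iE_i=qE_iK_i$, $[E_i,F_i]=\frac{K_i^2-K_i^{-2}}{q-q^{-1}}$, and for $i\ne j$: $K_iE_j=q^{-1/2}E_jK_i$, $[E_i,F_j]=0$, $E_i^2E_j+E_jE_i^2=(q+q^{-1})E_iE_jE_i$; $\Delta(K_i)=K_i\otimes K_i$, $\Delta(E_i)=E_i\otimes K_i+K_i^{-1}\otimes E_i$, $\Delta(F_i)=F_i\otimes K_i+K_i^{-1}\otimes F_i$; $\epsilon(K_i)=1$, $\epsilon(E_i)=\epsilon(F_i)=0$; $S(K_i)=K_i^{-1}$, $S(E_i)=-qE_i$, $S(F_i)=-q^{-1}F_i$. $\mathcal A(SU_q(3))$ is the Hopf $*$-algebra generated by $u^i_j$ ($i,j=1,2,3$) with $u^i_ku^j_k=qu^j_ku^i_k$ and $u^k_iu^k_j=qu^k_ju^k_i$ for $i<j$; $[u^i_l,u^j_k]=0$ and $[u^i_k,u^j_l]=(q-q^{-1})u^i_lu^j_k$ for $i<j$, $k<l$; $\sum_{\pi\in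 S_3}(-q)^{\ell(\pi)}u^1_{\pi(1)}u^2_{\pi(2)}u^3_{\pi(3)}=1$; $(u^i_j)^*=(-q)^{j-i}(u^{k_1}_{l_1}u^{k_2}_{l_2}-qu^{k_1}_{l_2}u^{k_2}_{l_1})$, where $\{k_1<k_2\}=\{1,2,3\}\setminus\{i\}$, $\{l_1<l_2\}=\{1,2,3\}\setminus\{j\}$; $\Delta(u^i_j)=\sum_ku^i_k\otimes u^k_j$. It carries a right action of $U_q(\mathfrak{su}(3))$ with $(ab)\triangleleft h=(a\triangleleft h_{(1)})(b\triangleleft h_{(2)})$, $1\triangleleft h=\epsilon(h)1$, $(a\triangleleft h)^*=a^*\triangleleft S(h)^*$, and $u^j_k\triangleleft K_i=q^{\frac12(\delta_{i+1,j}-\delta_{i,j})}u^j_k$, $u^j_k\triangleleft E_i=\delta_{i+1,j}u^i_k$, $u^j_k\triangleleft F_i=\delta_{i,j}u^{i+1}_k$. $\mathcal A(\mathbb CP^2_q)=\{a\in\mathcal A(SU_q(3)): a\triangleleft h=\epsilon(h)a$ for $h$ in the subalgebra $U_q(\mathfrak u(2))$ generated by $K_1^{\pm1},E_1,F_1,(K_1K_2^2)^{\pm1}\}$. $L^2(SU_q(3))$ is the completion of $\mathcal A(SU_q(3))$ for $\langle a,b\rangle=h(a^*b)$, $h$ the (faithful) Haar state. By Peter–Weyl it is the Hilbert space direct sum, over the irreducible representations $V(n_1,n_2)$, $(n_1,n_2)\in\mathbb N^2$, of the finite-dimensional spaces of matrix coefficients $V(n_1,n_2)\otimes V(n_1,n_2)$,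 each invariant under the right action; the action $\triangleleft$ is extended to $L^2(SU_q(3))$ block by block (as formal, possibly non-square-summable, sums). $L^2(\mathbb CP^2_q)$ is the subspace of $U_q(\mathfrak u(2))$-invariant elements of $L^2(SU_q(3))$, equivalently the closure of $\mathcal A(\mathbb CP^2_q)$. The unbounded operator $Z$ on $L^2(SU_q(3))$ is $Z(a)=(a\triangleleft F_2F_1,\ a\triangleleft F_2)$ with domain $\mathrm{Dom}(Z)=\{a\in L^2(SU_q(3)):(a\triangleleft F_2F_1,a\triangleleft F_2)\in L^2(SU_q(3))^2\}$. *)

(* Defs.v *)
From HB Require Import structures.
From mathcomp Require Import all_boot all_order all_algebra perm.
From mathcomp Require Import complex.
From mathcomp Require Import all_classical all_reals all_analysis.

Set Implicit Arguments.
Unset Strict Implicit.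
Unset Printing Implicit Defensive.

Import Order.TTheory GRing.Theory Num.Theory.
Import numFieldNormedType.Exports.

Local Open Scope classical_set_scope.
Local Open Scope ring_scope.

(* The algebra presented by generators and relations.  [pres_rel] states the
   relations for a family of elements of an arbitrary algebra.  Two
   noncommutative polynomials in the generators are identified when they agree
   on every family satisfying the relations (equivalently, when their
   difference lies in the two-sided ideal spanned by the relations).
   MathComp algebras are nonzero, whence [pres_nontrivial]. *)
Record presentation (C : fieldType) := Presentation {
  pres_gen : Type;
  pres_rel : forall B : algType C, (pres_gen -> B) -> Prop;
  pres_nontrivial : exists (B : algType C) (x : pres_gen -> B), pres_rel x }.

Inductive ncpoly (C G : Type) :=
  | NCgen of G
  | NCconst of C
  | NCadd of ncpoly C G & ncpoly C G
  | NCmul of ncpoly C G & ncpoly C G.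
Arguments NCgen {C G}.
Arguments NCconst {C G}.

HB.instance Definition _ (C G : Type) := gen_eqMixin (ncpoly C G).
HB.instance Definition _ (C G : Type) := gen_choiceMixin (ncpoly C G).

Fixpoint nceval (C : fieldType) (G : Type) (B : algType C) (x : G -> B)
    (t : ncpoly C G) : B :=
  match t with
  | NCgen g => x g
  | NCconst c => c%:A
  | NCadd t1 t2 => nceval x t1 + nceval x t2
  | NCmul t1 t2 => nceval x t1 * nceval x t2
  end.

Section Presented.
Variables (C : fieldType) (p : presentation C).
Local Notation term := (ncpoly C (pres_gen p)).

Definition pres_eqv : rel term := fun s t =>
  `[< forall (B : algType C) (x : pres_gen p -> B), pres_rel x ->
        nceval x s = nceval x t >].

Lemma pres_eqv_refl : reflexive pres_eqv.
Proof. by move=> t; apply/asboolP. Qed.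

Lemma pres_eqv_sym : symmetric pres_eqv.
Proof.
by move=> s t; apply/asboolP/asboolP => st B x px; rewrite (st _ _ px).
Qed.

Lemma pres_eqv_trans : transitive pres_eqv.
Proof.
move=> s t u /asboolP ts /asboolP su; apply/asboolP => B x px.
by rewrite (ts _ _ px) (su _ _ px).
Qed.

Canonical pres_equiv := EquivRel pres_eqv pres_eqv_refl pres_eqv_sym
  pres_eqv_trans.

Definition presented := {eq_quot pres_eqv}%qT.

HB.instance Definition _ := Choice.on presented.

Local Notation cls t := (\pi_presented t)%qT.

Lemma presP (s t : term) :
  (forall (B : algType C) (x : pres_gen p -> B), pres_rel x ->
     nceval x s = nceval x t) <-> cls s = cls t.
Proof. by split=> [st|/eqmodP/asboolP//]; apply/eqmodP/asboolP. Qed.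

Let rp (a : presented) : term := repr a.

Definition pres_add (a b : presented) : presented := cls (NCadd (rp a) (rp b)).
Definition pres_mul (a b : presented) : presented := cls (NCmul (rp a) (rp b)).
Definition pres_const (c : C) : presented := cls (NCconst c).
Definition pres_scale (c : C) (a : presented) : presented :=
  pres_mul (pres_const c) a.
Definition pres_opp (a : presented) : presented := pres_scale (- 1) a.

Lemma nceval_rp (t : term) (B : algType C) (x : pres_gen p -> B) :
  pres_rel x -> nceval x (rp (cls t)) = nceval x t.
Proof. by move: B x; apply/presP; rewrite /rp reprK. Qed.

Lemma pres_ext (a b : presented) :
  (forall (B : algType C) (x : pres_gen p -> B), pres_rel x ->
     nceval x (rp a) = nceval x (rp b)) -> a = b.
Proof. by move/presP; rewrite /rp !reprK. Qed.

Lemma nceval_add a b (B : algType C) (x : pres_gen p -> B) : pres_rel x ->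
  nceval x (rp (pres_add a b)) = nceval x (rp a) + nceval x (rp b).
Proof. by move=> px; rewrite nceval_rp. Qed.

Lemma nceval_mul a b (B : algType C) (x : pres_gen p -> B) : pres_rel x ->
  nceval x (rp (pres_mul a b)) = nceval x (rp a) * nceval x (rp b).
Proof. by move=> px; rewrite nceval_rp. Qed.

Lemma nceval_const c (B : algType C) (x : pres_gen p -> B) : pres_rel x ->
  nceval x (rp (pres_const c)) = c%:A.
Proof. by move=> px; rewrite nceval_rp. Qed.

Lemma nceval_scale c a (B : algType C) (x : pres_gen p -> B) : pres_rel x ->
  nceval x (rp (pres_scale c a)) = c *: nceval x (rp a).
Proof.
by move=> px; rewrite nceval_mul// nceval_const// -scalerAl mul1r.
Qed.

Let evE := (nceval_add, nceval_mul, nceval_scale, nceval_const).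

Lemma pres_addA : associative pres_add.
Proof. by move=> a b c; apply: pres_ext => B x px; rewrite !evE// addrA. Qed.
Lemma pres_addC : commutative pres_add.
Proof. by move=> a b; apply: pres_ext => B x px; rewrite !evE// addrC. Qed.
Lemma pres_add0 : left_id (pres_const 0) pres_add.
Proof.
by move=> a; apply: pres_ext => B x px; rewrite !evE// scale0r add0r.
Qed.
Lemma pres_addN : left_inverse (pres_const 0) pres_opp pres_add.
Proof.
move=> a; apply: pres_ext => B x px; rewrite /pres_opp !evE// scale0r.
by rewrite scaleN1r addNr.
Qed.

HB.instance Definition _ :=
  GRing.isZmodule.Build presented pres_addA pres_addC pres_add0 pres_addN.

Lemma pres_mulA : associative pres_mul.
Proof. by move=> a b c; apply: pres_ext => B x px; rewrite !evE// mulrA. Qed.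
Lemma pres_mul1l : left_id (pres_const 1) pres_mul.
Proof.
by move=> a; apply: pres_ext => B x px; rewrite !evE// scale1r mul1r.
Qed.
Lemma pres_mul1r : right_id (pres_const 1) pres_mul.
Proof.
by move=> a; apply: pres_ext => B x px; rewrite !evE// scale1r mulr1.
Qed.
Lemma pres_mulDl : left_distributive pres_mul pres_add.
Proof. by move=> a b c; apply: pres_ext => B x px; rewrite !evE// mulrDl. Qed.
Lemma pres_mulDr : right_distributive pres_mul pres_add.
Proof. by move=> a b c; apply: pres_ext => B x px; rewrite !evE// mulrDr. Qed.
Lemma pres_1neq0 : pres_const 1 != pres_const 0.
Proof.
apply/eqP => /presP e; have [B [x px]] := pres_nontrivial p.
by move/eqP: (e B x px); rewrite /= scale1r scale0r oner_eq0.
Qed.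

HB.instance Definition _ :=
  GRing.Zmodule_isNzRing.Build presented pres_mulA pres_mul1l pres_mul1r
    pres_mulDl pres_mulDr pres_1neq0.

Lemma pres_scaleA (c d : C) (a : presented) :
  pres_scale c (pres_scale d a) = pres_scale (c * d) a.
Proof. by apply: pres_ext => B x px; rewrite !evE// scalerA. Qed.
Lemma pres_scale1 : left_id 1 pres_scale.
Proof. by move=> a; apply: pres_ext => B x px; rewrite !evE// scale1r. Qed.
Lemma pres_scaleDr : right_distributive pres_scale +%R.
Proof.
by move=> c a b; apply: pres_ext => B x px; rewrite !evE// scalerDr.
Qed.
Lemma pres_scaleDl (a : presented) :
  {morph pres_scale^~ a : c d / c + d >-> c + d}.
Proof. by move=> c d; apply: pres_ext => B x px; rewrite !evE// scalerDl. Qed.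

HB.instance Definition _ :=
  GRing.Zmodule_isLmodule.Build C presented pres_scaleA pres_scale1
    pres_scaleDr pres_scaleDl.

Lemma pres_scaleAl (c : C) (a b : presented) :
  pres_scale c (pres_mul a b) = pres_mul (pres_scale c a) b.
Proof. by apply: pres_ext => B x px; rewrite !evE// scalerAl. Qed.

HB.instance Definition _ :=
  GRing.Lmodule_isLalgebra.Build C presented pres_scaleAl.

Lemma pres_scaleAr (c : C) (a b : presented) :
  pres_scale c (pres_mul a b) = pres_mul a (pres_scale c b).
Proof. by apply: pres_ext => B x px; rewrite !evE// scalerAr. Qed.

HB.instance Definition _ :=
  GRing.Lalgebra_isAlgebra.Build C presented pres_scaleAr.

Definition pgen (g : pres_gen p) : presented := cls (NCgen g).

Section Lift.
Variables (B : algType C) (x : pres_gen p -> B) (px : pres_rel x).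

Definition pres_lift of pres_rel x := fun a : presented => nceval x (rp a).

Lemma pres_lift_linear : linear (pres_lift px).
Proof.
move=> c a b; rewrite /pres_lift.
by rewrite -[c *: a + b]/(pres_add (pres_scale c a) b) !evE.
Qed.

Lemma pres_lift_monoid : monoid_morphism (pres_lift px).
Proof.
split=> [|a b]; rewrite /pres_lift.
  by rewrite -[1]/(pres_const 1) evE// scale1r.
by rewrite -[a * b]/(pres_mul a b) evE.
Qed.

HB.instance Definition _ :=
  GRing.isLinear.Build C presented B _ (pres_lift px) pres_lift_linear.
HB.instance Definition _ :=
  GRing.isMonoidMorphism.Build presented B (pres_lift px) pres_lift_monoid.

Lemma pres_lift_gen g : pres_lift px (pgen g) = x g.
Proof. exact: nceval_rp. Qed.

End Lift.

Lemma pres_lift_inj (a b : presented) :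
  (forall (B : algType C) (x : pres_gen p -> B) (px : pres_rel x),
     pres_lift px a = pres_lift px b) -> a = b.
Proof. by move=> ab; apply: pres_ext => B x px; apply: (ab B x px). Qed.

Lemma nceval_lift (B : algType C) (x : pres_gen p -> B) (px : pres_rel x) t :
  pres_lift px (nceval pgen t) = nceval x t.
Proof.
elim: t => [g|c|s IHs t IHt|s IHs t IHt] /=.
- exact: pres_lift_gen.
- by rewrite linearZ/= rmorph1.
- by rewrite linearD/= IHs IHt.
- by rewrite rmorphM/= IHs IHt.
Qed.

Lemma nceval_pgen t : nceval pgen t = cls t.
Proof.
by apply: pres_lift_inj => B x px; rewrite nceval_lift /pres_lift nceval_rp.
Qed.

End Presented.

(* Elements of the algebraic tensor products V (x) W and V (x) V (x) V are
   represented by finite sums of pure tensors; by the universal property of the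
   tensor product, two such sums represent the same tensor iff all multilinear
   maps agree on them. *)
Section Tensors.
Variable C : fieldType.

Definition tensor2_eq (V W : lmodType C) (s t : seq (V * W)) : Prop :=
  forall (X : lmodType C) (f : V -> W -> X),
    (forall v, linear (f v)) -> (forall w, linear (f^~ w)) ->
    \sum_(p <- s) f p.1 p.2 = \sum_(p <- t) f p.1 p.2.

Definition tensor3_eq (V : lmodType C) (s t : seq (V * V * V)) : Prop :=
  forall (X : lmodType C) (f : V -> V -> V -> X),
    (forall v w, linear (f v w)) -> (forall u w, linear (fun v => f u v w)) ->
    (forall u v, linear (fun w => f w u v)) ->
    \sum_(p <- s) f p.1.1 p.1.2 p.2 = \sum_(p <- t) f p.1.1 p.1.2 p.2.

End Tensors.

Record hopf_star_algebra (C : numClosedFieldType) (A : algType C) :=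
  HopfStarAlgebra {
  comul : A -> seq (A * A);
  counit : {lrmorphism A -> C^o};
  antipode : {linear A -> A};
  star : A -> A;
  comulP : forall (c : C) (a b : A), tensor2_eq (comul (c *: a + b))
    ([seq (c *: p.1, p.2) | p <- comul a] ++ comul b);
  comul1 : tensor2_eq (comul 1) [:: (1, 1)];
  comulM : forall a b : A, tensor2_eq (comul (a * b))
    [seq (p.1 * r.1, p.2 * r.2) | p <- comul a, r <- comul b];
  comulA : forall a : A, tensor3_eq
    [seq (r.1, r.2, p.2) | p <- comul a, r <- comul p.1]
    [seq (p.1, r.1, r.2) | p <- comul a, r <- comul p.2];
  counitl : forall a : A, \sum_(p <- comul a) (counit p.1 : C) *: p.2 = a;
  counitr : forall a : A, \sum_(p <- comul a) (counit p.2 : C) *: p.1 = a;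
  antipodel : forall a : A,
    \sum_(p <- comul a) antipode p.1 * p.2 = (counit a : C)%:A;
  antipoder : forall a : A,
    \sum_(p <- comul a) p.1 * antipode p.2 = (counit a : C)%:A;
  starP : forall (c : C) (a b : A), star (c *: a + b) = c^* *: star a + star b;
  starM : forall a b : A, star (a * b) = star b * star a;
  starK : involutive star;
  comul_star : forall a : A,
    tensor2_eq (comul (star a)) [seq (star p.1, star p.2) | p <- comul a] }.

(* The indices 1, 2 (resp. 1, 2, 3) of the mathematical notation are the
   elements 0, 1 of 'I_2 (resp. 0, 1, 2 of 'I_3).  [lo i] and [hi i] are i and
   i + 1, as row indices. *)
Definition lo (i : 'I_2) : 'I_3 := widen_ord (leqnSn 2) i.
Definition hi (i : 'I_2) : 'I_3 := lift ord0 i.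

Section QuantumSU3.
Variables (C : numClosedFieldType) (q : C).

Variant Uq_gens := GenK of 'I_2 | GenKV of 'I_2 | GenE of 'I_2 | GenF of 'I_2.

(* The adjoints of the relations between the K_i and the E_i are listed too,
   since F_i = E_i^*. *)
Record Uq_relations (B : algType C) (x : Uq_gens -> B) : Prop := {
  Uq_KKV : forall i, x (GenK i) * x (GenKV i) = 1;
  Uq_KVK : forall i, x (GenKV i) * x (GenK i) = 1;
  Uq_KK : forall i j, x (GenK i) * x (GenK j) = x (GenK j) * x (GenK i);
  Uq_KE : forall i, x (GenK i) * x (GenE i) = q *: (x (GenE i) * x (GenK i));
  Uq_FK : forall i, x (GenF i) * x (GenK i) = q *: (x (GenK i) * x (GenF i));
  Uq_EF : forall i, x (GenE i) * x (GenF i) - x (GenF i) * x (GenE i) =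
    (q - q^-1)^-1 *: (x (GenK i) ^+ 2 - x (GenKV i) ^+ 2);
  Uq_KE_ne : forall i j, i != j ->
    x (GenK i) * x (GenE j) = (sqrtC q)^-1 *: (x (GenE j) * x (GenK i));
  Uq_FK_ne : forall i j, i != j ->
    x (GenF j) * x (GenK i) = (sqrtC q)^-1 *: (x (GenK i) * x (GenF j));
  Uq_EF_ne : forall i j, i != j ->
    x (GenE i) * x (GenF j) = x (GenF j) * x (GenE i);
  Uq_SerreE : forall i j, i != j ->
    x (GenE i) ^+ 2 * x (GenE j) + x (GenE j) * x (GenE i) ^+ 2 =
    (q + q^-1) *: (x (GenE i) * x (GenE j) * x (GenE i));
  Uq_SerreF : forall i j, i != j ->
    x (GenF i) ^+ 2 * x (GenF j) + x (GenF j) * x (GenF i) ^+ 2 =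
    (q + q^-1) *: (x (GenF i) * x (GenF j) * x (GenF i)) }.

Lemma Uq_nontrivial : exists (B : algType C) (x : Uq_gens -> B), Uq_relations x.
Proof.
exists C^o, (fun g => match g with GenK _ | GenKV _ => 1 | _ => 0 end).
by split=> *; rewrite ?(mulr0, mul0r, mulr1, expr0n, addr0, subrr, scaler0).
Qed.

Definition Uq_presentation := Presentation Uq_nontrivial.
Definition Uq_su3 : algType C := presented Uq_presentation.

Definition UK (i : 'I_2) : Uq_su3 := pgen (GenK i : pres_gen Uq_presentation).
Definition UKV (i : 'I_2) : Uq_su3 := pgen (GenKV i : pres_gen Uq_presentation).
Definition UE (i : 'I_2) : Uq_su3 := pgen (GenE i : pres_gen Uq_presentation).
Definition UF (i : 'I_2) : Uq_su3 := pgen (GenF i : pres_gen Uq_presentation).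

Lemma Uq_gensP : Uq_relations (@pgen C Uq_presentation).
Proof.
by split=> *; apply: pres_lift_inj => B x px;
  rewrite ?(linearD, linearB, linearZ, rmorphM, rmorphXn, rmorph1)/=
    ?pres_lift_gen ?scaleN1r -?expr2; case: px => *; auto.
Qed.

(* Length of a permutation: its number of inversions. *)
Definition inversions (s : 'S_3) : nat :=
  #|[pred ij : 'I_3 * 'I_3 | (ij.1 < ij.2)%N && (s ij.2 < s ij.1)%N]|.

(* [x (i, j)] is the generator with upper index i and lower index j. *)
Record SUq3_relations (B : algType C) (x : 'I_3 * 'I_3 -> B) : Prop := {
  SUq3_col : forall i j k : 'I_3, (i < j)%N ->
    x (i, k) * x (j, k) = q *: (x (j, k) * x (i, k));
  SUq3_row : forall i j k : 'I_3, (i < j)%N ->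
    x (k, i) * x (k, j) = q *: (x (k, j) * x (k, i));
  SUq3_anti : forall i j k l : 'I_3, (i < j)%N -> (k < l)%N ->
    x (i, l) * x (j, k) = x (j, k) * x (i, l);
  SUq3_diag : forall i j k l : 'I_3, (i < j)%N -> (k < l)%N ->
    x (i, k) * x (j, l) - x (j, l) * x (i, k) =
    (q - q^-1) *: (x (i, l) * x (j, k));
  SUq3_det : \sum_(s : 'S_3) (- q) ^+ inversions s *:
    \prod_(i < 3) x (i, s i) = 1 }.

Lemma SUq3_nontrivial :
  exists (B : algType C) (x : 'I_3 * 'I_3 -> B), SUq3_relations x.
Proof.
exists C^o, (fun ij => (ij.1 == ij.2)%:R); split=> /=.
- move=> i j k ij; have [/eqP ik|ik] := boolP (i == k); last first.
    by rewrite mul0r mulr0 scaler0.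
  by rewrite -ik -val_eqE/= gtn_eqF// mul0r mulr0 scaler0.
- move=> i j k ij; have [/eqP ki|ki] := boolP (k == i); last first.
    by rewrite mul0r mulr0 scaler0.
  by rewrite ki -val_eqE/= ltn_eqF// mul0r mulr0 scaler0.
- by move=> i j k l ij kl; rewrite mulrC.
- move=> i j k l ij kl; rewrite mulrC subrr.
  have [/eqP il|il] := boolP (i == l); last by rewrite mul0r scaler0.
  rewrite -(val_eqE j k) /= gtn_eqF ?mulr0 ?scaler0//.
  by rewrite (ltn_trans kl)// -il.
- rewrite (bigD1 (1%g : 'S_3))//= [X in _ + X]big1 ?addr0 => [|s s1].
    rewrite big1 => [|i _]; last by rewrite perm1 eqxx.
    rewrite (_ : inversions _ = 0)%N ?expr0 ?scale1r//.
    apply: eq_card0 => -[i j]; rewrite !inE/= !perm1.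
    by apply/negP => /andP[ij /(ltn_trans ij)]; rewrite ltnn.
  have [i si|sE] := pickP (fun i => i != s i).
    by rewrite (bigD1 i)//= (negPf si) mul0r scaler0.
  case/eqP: s1; apply/permP => i; rewrite perm1; apply/esym/eqP/negPn.
  by rewrite sE.
Qed.

Definition SUq3_presentation := Presentation SUq3_nontrivial.
Definition ASUq3 : algType C := presented SUq3_presentation.

Lemma SUq3_gensP : SUq3_relations (@pgen C SUq3_presentation).
Proof.
split=> *; apply: pres_lift_inj => B x px; last first.
  rewrite linear_sum rmorph1 -(SUq3_det px); apply: eq_bigr => s _.
  rewrite linearZ/= rmorph_prod; congr (_ *: _); apply: eq_bigr => i _.
  by rewrite /= pres_lift_gen.
all: rewrite ?(linearB, linearZ, rmorphM)/= ?pres_lift_gen.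
all: by case: px => *; auto.
Qed.

Definition Au (i j : 'I_3) : ASUq3 :=
  pgen ((i, j) : pres_gen SUq3_presentation).

Record is_Uq_hopf (U : hopf_star_algebra Uq_su3) : Prop := {
  Uq_comulK : forall i, tensor2_eq (comul U (UK i)) [:: (UK i, UK i)];
  Uq_comulE : forall i,
    tensor2_eq (comul U (UE i)) [:: (UE i, UK i); (UKV i, UE i)];
  Uq_comulF : forall i,
    tensor2_eq (comul U (UF i)) [:: (UF i, UK i); (UKV i, UF i)];
  Uq_counitK : forall i, counit U (UK i) = 1;
  Uq_counitE : forall i, counit U (UE i) = 0;
  Uq_counitF : forall i, counit U (UF i) = 0;
  Uq_antipodeK : forall i, antipode U (UK i) = UKV i;
  Uq_antipodeE : forall i, antipode U (UE i) = - q *: UE i;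
  Uq_antipodeF : forall i, antipode U (UF i) = - q^-1 *: UF i;
  Uq_starK : forall i, star U (UK i) = UK i;
  Uq_starE : forall i, star U (UE i) = UF i }.

(* [lift i ord0] and [lift i ord_max] are the two elements, in increasing
   order, of 'I_3 minus i.  The counit and the antipode are determined by the
   comultiplication. *)
Record is_SUq3_hopf (A : hopf_star_algebra ASUq3) : Prop := {
  SUq3_comul : forall i j,
    tensor2_eq (comul A (Au i j)) [seq (Au i k, Au k j) | k : 'I_3];
  SUq3_star : forall i j : 'I_3, star A (Au i j) = (- q) ^ (j%:Z - i%:Z) *:
    (Au (lift i ord0) (lift j ord0) * Au (lift i ord_max) (lift j ord_max)
     - q *: (Au (lift i ord0) (lift j ord_max)
             * Au (lift i ord_max) (lift j ord0))) }.

(* [act a h] is the right action of h on a. *)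
Record is_right_action (U : hopf_star_algebra Uq_su3)
    (A : hopf_star_algebra ASUq3) (act : ASUq3 -> Uq_su3 -> ASUq3) : Prop := {
  act_linearl : forall h, linear (act^~ h);
  act_linearr : forall a, linear (act a);
  act_a1 : forall a, act a 1 = a;
  act_aM : forall a h k, act a (h * k) = act (act a h) k;
  act_1h : forall h, act 1 h = (counit U h : C)%:A;
  act_Mh : forall a b h,
    act (a * b) h = \sum_(p <- comul U h) act a p.1 * act b p.2;
  act_star : forall a h,
    star A (act a h) = act (star A a) (star U (antipode U h));
  act_uK : forall i j k, act (Au j k) (UK i) =
    sqrtC q ^ ((j == hi i)%:Z - (j == lo i)%:Z) *: Au j k;
  act_uE : forall i j k, act (Au j k) (UE i) =
    (j == hi i)%:R *: Au (lo i) k;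
  act_uF : forall i j k, act (Au j k) (UF i) =
    (j == lo i)%:R *: Au (hi i) k }.

Record is_haar_state (A : hopf_star_algebra ASUq3)
    (haar : {linear ASUq3 -> C^o}) : Prop := {
  haar1 : haar 1 = 1;
  haar_ge0 : forall a, (0 : C) <= haar (star A a * a);
  haar_faithful : forall a, haar (star A a * a) = 0 -> a = 0;
  haar_invl : forall a,
    \sum_(p <- comul A a) (haar p.1 : C) *: p.2 = (haar a : C)%:A;
  haar_invr : forall a,
    \sum_(p <- comul A a) (haar p.2 : C) *: p.1 = (haar a : C)%:A }.

Record quantum_SU3 := QuantumSU3 {
  qU : hopf_star_algebra Uq_su3;
  qU_hopf : is_Uq_hopf qU;
  qA : hopf_star_algebra ASUq3;
  qA_hopf : is_SUq3_hopf qA;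
  qact : ASUq3 -> Uq_su3 -> ASUq3;
  qact_action : is_right_action qU qA qact;
  qhaar : {linear ASUq3 -> C^o};
  qhaar_state : is_haar_state qA qhaar }.

Record L2_completion (S : quantum_SU3) := L2Completion {
  L2 : completeNormedModType C;
  L2ip : L2 -> L2 -> C;
  L2of : {linear ASUq3 -> L2};
  L2ip_linear : forall x, linear (L2ip x : L2 -> C^o);
  L2ip_sym : forall x y, L2ip x y = (L2ip y x)^*;
  L2ip_norm : forall x, L2ip x x = `|x| ^+ 2;
  L2ip_haar : forall a b, L2ip (L2of a) (L2of b) = qhaar S (star (qA S) a * b);
  L2_dense : dense (range L2of) }.

Section L2Theory.
Variables (S : quantum_SU3) (L : L2_completion S).
Local Notation A := ASUq3.
Local Notation U := Uq_su3.

Definition Uq_u2 : set U := smallest (fun B : set U => subalg_closed (mem B))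
  [set h | h = UK ord0 \/ h = UKV ord0 \/ h = UE ord0 \/ h = UF ord0 \/
           h = UK ord0 * UK ord_max ^+ 2 \/ h = UKV ord0 * UKV ord_max ^+ 2].

(* The irreducible representation V(n1,n2) is realised as the right U-module
   generated in A(SU_q(3)) by the highest weight vector
   ((u^1_1)^* )^n1 (u^3_3)^n2, which is killed by F_1 and F_2 (the raising
   operators of a right module) and on which K_i acts as q^(n_i/2). *)
Definition hw_vector (n1 n2 : nat) : A :=
  star (qA S) (Au ord0 ord0) ^+ n1 * Au ord_max ord_max ^+ n2.

Definition irrep (n1 n2 : nat) : set A := range (qact S (hw_vector n1 n2)).

(* Linear span of the matrix coefficients (id (x) f)(Delta v), for v in
   V(n1,n2) and f a linear form: irrep n1 n2 is a left coideal of A(SU_q(3)),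
   so Delta v lies in A (x) V(n1,n2). *)
Definition PW_block (n1 n2 : nat) : set A :=
  smallest (fun B : set A => submod_closed (mem B))
    [set a | exists v (f : {linear A -> C^o}), irrep n1 n2 v /\
       a = \sum_(p <- comul (qA S) v) (f p.2 : C) *: p.1].

(* x is the orthogonal sum of its components b n1 n2 in the blocks. *)
Definition PW_expansion (x : L2 L) (b : nat -> nat -> A) : Prop :=
  (forall n1 n2, PW_block n1 n2 (b n1 n2)) /\
  (fun N : nat => \sum_(n1 < N) \sum_(n2 < N) L2of L (b n1 n2)) @ \oo --> x.

(* The formal sum obtained by acting with h on x, block by block, is
   square-summable, with sum y. *)
Definition L2_act (x : L2 L) (h : U) (y : L2 L) : Prop :=
  exists b, PW_expansion x b /\ PW_expansion y (fun n1 n2 => qact S (b n1 n2) h).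

Definition L2_CP2 : set (L2 L) :=
  [set x | forall h, Uq_u2 h -> L2_act x h ((counit (qU S) h : C) *: x)].

Definition Z_dom : set (L2 L) :=
  [set x | (exists y, L2_act x (UF ord_max * UF ord0) y) /\
           (exists y, L2_act x (UF ord_max) y)].

(* On [Z_dom] both components are the unique y of [L2_act]. *)
Definition Z (x : L2 L) : L2 L * L2 L :=
  (xget 0 (L2_act x (UF ord_max * UF ord0)), xget 0 (L2_act x (UF ord_max))).

End L2Theory.

End QuantumSU3.

(* Main.v *)
(* Write <a, b> = h(a^* b).  For each generator g of U_q(su(3)), <a <| g, b> is
   a nonzero multiple of <a, b <| g^*>, because the Haar state is invariant.  So
   a condition on the blockwise action on x becomes one on the functional
   phi(a) = <x, a> on A(SU_q(3)), whatever expansion of x is used, and the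
   orthogonality of the Peter-Weyl blocks is not needed.
   If x is in L^2(CP^2_q) and in the kernel of <| F_2, then phi is invariant
   under K_1, E_1, F_1 and K_2^2 and vanishes on the range of E_2.  In a locally
   finite module over the U_q(su(2)) generated by K_2, E_2, F_2, a functional of
   weight zero that vanishes on the range of E_2 also vanishes on the range of
   F_2, so phi is invariant under all of U_q(su(3)).  As K_i acts on the highest
   weight vector of V(n1,n2) by q^(n_i/2), phi vanishes on every block but the
   one of the unit, and x is a scalar. *)

From HB Require Import structures.
Require Import Defs.
From mathcomp Require Import all_boot all_order all_algebra.
From mathcomp Require Import complex.
From mathcomp Require Import all_classical all_reals all_analysis.
From mathcomp Require Import ring zify.

Set Implicit Arguments.
Unset Strict Implicit.
Unset Printing Implicit Defensive.

Import Order.TTheory GRing.Theory Num.Theory.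
Import numFieldNormedType.Exports.

Local Open Scope classical_set_scope.
Local Open Scope ring_scope.

(** * Consequences of the predicate [linear] for unbundled maps *)

Section LinearProp.
Variables (C : fieldType) (V W : lmodType C) (f : V -> W).
Hypothesis flin : linear f.

Lemma lin0 : f 0 = 0.
Proof. by have := flin (-1) 0 0; rewrite scaler0 addr0 scaleN1r addNr. Qed.

Lemma linD a b : f (a + b) = f a + f b.
Proof. by rewrite -{1}[a]scale1r flin scale1r. Qed.

Lemma linZ c a : f (c *: a) = c *: f a.
Proof. by rewrite -[c *: a]addr0 flin lin0 addr0. Qed.

Lemma linB a b : f (a - b) = f a - f b.
Proof. by rewrite -scaleN1r linD linZ scaleN1r. Qed.

Lemma lin_sum (I : Type) (r : seq I) (F : I -> V) :
  f (\sum_(i <- r) F i) = \sum_(i <- r) f (F i).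
Proof. exact: (big_morph f linD lin0). Qed.

End LinearProp.

(** Each class is the value of a representative polynomial at the generators, so structural
    induction on polynomials applies. *)
Lemma presented_ind (C : fieldType) (p : presentation C)
    (P : presented p -> Prop) :
  (forall g, P (pgen g)) -> P 1 -> (forall c a, P a -> P (c *: a)) ->
  (forall a b, P a -> P b -> P (a + b)) ->
  (forall a b, P a -> P b -> P (a * b)) -> forall a, P a.
Proof.
move=> Pg P1 PZ PD PM a.
have -> : a = nceval (@pgen C p) (repr a) by rewrite nceval_pgen reprK.
by elim: (repr a) => [g|c|s Ps t Pt|s Ps t Pt] /=; auto.
Qed.

Definition bilinear2 (C : fieldType) (V W X : lmodType C) (g : V -> W -> X) :=
  (forall v, linear (g v)) /\ (forall w, linear (g^~ w)).

(** * Sweedler sums in a Hopf star-algebra *)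

Section Comul.
Variables (C : numClosedFieldType) (A : algType C) (H : hopf_star_algebra A).

(** [comul] represents a tensor only up to [tensor2_eq]; for bilinear [g] the sum depends on the
    tensor alone. *)
Definition comul_sum (X : lmodType C) (g : A -> A -> X) (a : A) : X :=
  \sum_(p <- comul H a) g p.1 p.2.

Section Bilinear.
Variables (X : lmodType C) (g : A -> A -> X).
Hypothesis glin : bilinear2 g.

Lemma comul_sum_linear : linear (comul_sum g).
Proof.
move=> c a b; rewrite /comul_sum (comulP H c a b glin.1 glin.2) big_cat big_map.
rewrite scaler_sumr; congr (_ + _); apply: eq_bigr => p _.
exact: (linZ (glin.2 _)).
Qed.

Lemma comul_sum1 : comul_sum g 1 = g 1 1.
Proof. by rewrite /comul_sum (comul1 H glin.1 glin.2) big_seq1. Qed.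

Lemma comul_sumM a b : comul_sum g (a * b) =
  \sum_(p <- comul H a) \sum_(r <- comul H b) g (p.1 * r.1) (p.2 * r.2).
Proof.
by rewrite /comul_sum (comulM H a b glin.1 glin.2) big_allpairs_dep.
Qed.

End Bilinear.

Lemma star1 : star H 1 = 1.
Proof. by rewrite -[LHS]mulr1 -{2}(starK H 1) -starM mulr1 starK. Qed.

Lemma star_linZ c a : star H (c *: a) = c^* *: star H a.
Proof.
have s0 : star H 0 = 0.
  have := starP H (-1) 0 0; rewrite scaler0 addr0 rmorphN1 scaleN1r.
  by rewrite addNr.
by rewrite -[c *: a]addr0 starP s0 addr0.
Qed.

End Comul.

(** * The right action on products and on generators *)

Section QuantumGroup.
Variables (C : numClosedFieldType) (q : C).
Hypotheses (q_gt0 : 0 < q) (q_lt1 : q < 1).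
Variable S : quantum_SU3 q.

Local Notation A := (ASUq3 q).
Local Notation U := (Uq_su3 q).
Local Notation act := (qact S).
Local Notation eps := (counit (qU S)).
Local Notation haar := (qhaar S).
Local Notation ugen g := (pgen (g : pres_gen (Uq_presentation q))).

Let actP := qact_action S.

Lemma act_linl h : linear (act^~ h). Proof. exact: act_linearl actP h. Qed.
Lemma act_linr a : linear (act a). Proof. exact: act_linearr actP a. Qed.

Definition coproduct_terms (g : Uq_gens) : seq (U * U) :=
  match g with
  | GenK i => [:: (UK q i, UK q i)]
  | GenKV i => [:: (UKV q i, UKV q i)]
  | GenE i => [:: (UE q i, UK q i); (UKV q i, UE q i)]
  | GenF i => [:: (UF q i, UK q i); (UKV q i, UF q i)]
  end.

Lemma act_mul_bilinear a b : bilinear2 (fun h k => act a h * act b k).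
Proof.
split=> [h|k] c u v; first by rewrite act_linr mulrDr scalerAr.
by rewrite act_linr mulrDl scalerAl.
Qed.

Lemma act_M_K a b i : act (a * b) (UK q i) = act a (UK q i) * act b (UK q i).
Proof.
rewrite (act_Mh actP).
have [l r] := act_mul_bilinear a b.
by rewrite (Uq_comulK (qU_hopf S) i l r) big_seq1.
Qed.

Lemma act_KKV a i : act (act a (UK q i)) (UKV q i) = a.
Proof.
by rewrite -(act_aM actP) (Uq_KKV (Uq_gensP q)) (act_a1 actP).
Qed.

Lemma act_KVK a i : act (act a (UKV q i)) (UK q i) = a.
Proof.
by rewrite -(act_aM actP) (Uq_KVK (Uq_gensP q)) (act_a1 actP).
Qed.

(** K_i acts multiplicatively and bijectively, hence so does its inverse; this replaces a coproduct
    formula for K_i^{-1}. *)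
Lemma act_M_KV a b i :
  act (a * b) (UKV q i) = act a (UKV q i) * act b (UKV q i).
Proof.
by rewrite -{1}[a](act_KVK _ i) -{1}[b](act_KVK _ i) -act_M_K act_KKV.
Qed.

Lemma act_M_gen a b g : act (a * b) (ugen g) =
  \sum_(d <- coproduct_terms g) act a d.1 * act b d.2.
Proof.
have [l r] := act_mul_bilinear a b.
case: g => i; rewrite ?big_seq1.
- exact: act_M_K.
- exact: act_M_KV.
- rewrite (act_Mh actP); exact: (Uq_comulE (qU_hopf S) i l r).
- rewrite (act_Mh actP); exact: (Uq_comulF (qU_hopf S) i l r).
Qed.

Lemma act_M_E a b i : act (a * b) (UE q i) =
  act a (UE q i) * act b (UK q i) + act a (UKV q i) * act b (UE q i).
Proof. by rewrite [LHS](act_M_gen a b (GenE i)) big_cons big_seq1. Qed.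

Lemma act_M_F a b i : act (a * b) (UF q i) =
  act a (UF q i) * act b (UK q i) + act a (UKV q i) * act b (UF q i).
Proof. by rewrite [LHS](act_M_gen a b (GenF i)) big_cons big_seq1. Qed.

Lemma q_neq0 : q != 0. Proof. by rewrite gt_eqF. Qed.

Lemma sqrtq_gt0 : 0 < sqrtC q. Proof. by rewrite sqrtC_gt0. Qed.
Lemma sqrtq_neq0 : sqrtC q != 0. Proof. by rewrite gt_eqF// sqrtq_gt0. Qed.

Lemma act_uKV i j k : act (Au q j k) (UKV q i) =
  (sqrtC q ^ (- ((j == hi i)%:Z - (j == lo i)%:Z))) *: (Au q j k : A).
Proof.
rewrite -[in RHS](act_KKV (Au q j k) i) (act_uK actP) (linZ (act_linl _)).
by rewrite scalerA -expfzDr ?sqrtq_neq0// addNr expr0z scale1r.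
Qed.

(** The scalar and the new upper index are independent of [k]. As Delta(u^j_k) keeps the upper index
    j in its first leg, this is the base case of [comul_act_gen]. *)
Lemma act_u_gen g j : exists c j', forall k,
  act (Au q j k) (ugen g) = c *: Au q j' k.
Proof.
case: g => i.
- by eexists _, _ => k; exact: act_uK actP i j k.
- by eexists _, _ => k; exact: act_uKV i j k.
- by eexists _, _ => k; exact: act_uE actP i j k.
- by eexists _, _ => k; exact: act_uF actP i j k.
Qed.

(** * The action and the coproduct of A(SU_q(3)) *)

Local Notation csum := (comul_sum (qA S)).

Lemma csum_Au (X : lmodType C) (g : A -> A -> X) j k : bilinear2 g ->
  csum g (Au q j k) = \sum_i g (Au q j i) (Au q i k).
Proof.
move=> [gl gr]; rewrite /comul_sum (SUq3_comul (qA_hopf S) j k gl gr).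
by rewrite big_map big_enum.
Qed.

Lemma act_bilinear (X : lmodType C) (g : A -> A -> X) h : bilinear2 g ->
  bilinear2 (fun v w => g (act v h) w).
Proof.
move=> [gl gr]; split=> [v|w] c a b; first exact: gl.
by rewrite act_linl (gr w).
Qed.

(** The action moves upper indices, which live in the first leg. For a product, Delta(g) again
    consists of generators, and the induction hypotheses are used for other [g] and [f]; hence the
    generalisation over both. *)
Lemma comul_act_gen g a (X : lmodType C) (f : A -> A -> X) : bilinear2 f ->
  csum f (act a (ugen g)) = csum (fun v w => f (act v (ugen g)) w) a.
Proof.
elim/presented_ind: a g X f =>
  [[j k]||c a IHa|a b IHa IHb|a b IHa IHb] g X f fl.
- have fgl := act_bilinear (ugen g) fl.
  rewrite -[pgen _]/(Au q j k) csum_Au//.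
  have [c [j' E]] := act_u_gen g j.
  rewrite E (linZ (comul_sum_linear (qA S) fl)) csum_Au// scaler_sumr.
  by apply: eq_bigr => i _; rewrite E (linZ (fl.2 _)).
- have fgl := act_bilinear (ugen g) fl.
  rewrite comul_sum1// (act_1h actP) (linZ (comul_sum_linear (qA S) fl)).
  by rewrite comul_sum1// (linZ (fl.2 _)).
- have fgl := act_bilinear (ugen g) fl.
  rewrite (linZ (act_linl _)) (linZ (comul_sum_linear (qA S) fl)) IHa//.
  by rewrite (linZ (comul_sum_linear (qA S) fgl)).
- have fgl := act_bilinear (ugen g) fl.
  rewrite (linD (act_linl _)) (linD (comul_sum_linear (qA S) fl)) IHa// IHb//.
  by rewrite (linD (comul_sum_linear (qA S) fgl)).
- have fgl := act_bilinear (ugen g) fl.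
  have [fl1 fl2] := fl.
  have mul1 x y : bilinear2 (fun v w => f (x * v) (y * w)).
    split=> [v|w] c u t; first by rewrite mulrDr -scalerAr fl1.
    by rewrite mulrDr -scalerAr (fl2 _).
  have mul2 (h : U) (D : seq (A * A)) :
      bilinear2 (fun v w => \sum_(r <- D) f (v * act r.1 h) (w * r.2)).
    split=> [v|w] c u t; rewrite scaler_sumr -big_split;
      apply: eq_bigr => r _ /=.
      by rewrite mulrDl -scalerAl fl1.
    by rewrite mulrDl -scalerAl (fl2 _).
  (* The factor [b] is treated first, against a fixed term of the coproduct of the other factor;
     then [a], against the whole sum over the coproduct of [b]. *)
  have step h' k' : csum f (act a (ugen h') * act b (ugen k')) =
      \sum_(p <- comul (qA S) a) \sum_(r <- comul (qA S) b)
        f (act p.1 (ugen h') * act r.1 (ugen k')) (p.2 * r.2).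
    rewrite comul_sumM//.
    transitivity (\sum_(p <- comul (qA S) (act a (ugen h')))
        csum (fun v w => f (p.1 * act v (ugen k')) (p.2 * w)) b).
      by apply: eq_bigr => p _; exact: IHb (mul1 p.1 p.2).
    exact: IHa (mul2 (ugen k') (comul (qA S) b)).
  have -> : csum f (act (a * b) (ugen g)) = \sum_(d <- coproduct_terms g)
      \sum_(p <- comul (qA S) a) \sum_(r <- comul (qA S) b)
        f (act p.1 d.1 * act r.1 d.2) (p.2 * r.2).
    rewrite act_M_gen (lin_sum (comul_sum_linear (qA S) fl)).
    case: g {fgl} => i; rewrite !big_cons !big_nil /=.
    - by rewrite (step (GenK i) (GenK i)).
    - by rewrite (step (GenKV i) (GenKV i)).
    - by rewrite (step (GenE i) (GenK i)) (step (GenKV i) (GenE i)).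
    - by rewrite (step (GenF i) (GenK i)) (step (GenKV i) (GenF i)).
  rewrite comul_sumM// exchange_big; apply: eq_bigr => p _.
  rewrite exchange_big; apply: eq_bigr => r _ /=.
  by rewrite act_M_gen (lin_sum (fl2 _)).
Qed.

Lemma comul_act h a (X : lmodType C) (f : A -> A -> X) : bilinear2 f ->
  csum f (act a h) = csum (fun v w => f (act v h) w) a.
Proof.
elim/presented_ind: h a X f => [g||c h IHh|h k IHh IHk|h k IHh IHk] a X f fl.
- exact: comul_act_gen.
- rewrite (act_a1 actP); apply: eq_bigr => p _.
  by rewrite (act_a1 actP).
- rewrite (linZ (act_linr _)) (linZ (comul_sum_linear (qA S) fl)) IHh//.
  rewrite /comul_sum scaler_sumr; apply: eq_bigr => p _.
  by rewrite (linZ (act_linr _)) (linZ (fl.2 _)).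
- rewrite (linD (act_linr _)) (linD (comul_sum_linear (qA S) fl)) IHh// IHk//.
  rewrite /comul_sum -big_split; apply: eq_bigr => p _ /=.
  by rewrite (linD (act_linr _)) (linD (fl.2 _)).
- rewrite (act_aM actP) IHk// IHh; last exact: act_bilinear.
  by apply: eq_bigr => p _; rewrite (act_aM actP).
Qed.

Definition coef (f : {linear A -> C^o}) (a : A) : A :=
  \sum_(p <- comul (qA S) a) (f p.2 : C) *: p.1.

Lemma coef_bilinear (f : {linear A -> C^o}) :
  bilinear2 (fun v w : A => (f w : C) *: v).
Proof.
split=> [v|w] c a b; first by rewrite linearP/= scalerDl scalerA.
by rewrite scalerDr !scalerA mulrC.
Qed.

(** The form [f] sits on the second leg, which the action leaves alone. *)
Lemma coef_act f h a : coef f (act a h) = act (coef f a) h.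
Proof.
rewrite [LHS](comul_act h a (coef_bilinear f)) (lin_sum (act_linl h)).
by apply: eq_bigr => p _; rewrite (linZ (act_linl h)).
Qed.

(** By invariance [coef haar] sends a to haar(a) 1, so [coef_act] compares haar(a <| h) 1 with
    haar(a) (1 <| h). *)
Lemma haar_act a h : haar (act a h) = eps h * haar a.
Proof.
have E b : coef haar b = (haar b : C)%:A := haar_invr (qhaar_state S) b.
have := coef_act haar h a; rewrite !E (linZ (act_linl h)) (act_1h actP) scalerA.
move/(congr1 haar); rewrite !linearZ /= (haar1 (qhaar_state S)).
by rewrite /GRing.scale /= !mulr1 mulrC.
Qed.

(** * Adjoints of the generators for the Haar inner product *)

Lemma counitKV i : eps (UKV q i) = 1.
Proof.
rewrite -[LHS]mul1r -{1}(Uq_counitK (qU_hopf S) i) -rmorphM.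
by rewrite /UK /UKV (Uq_KKV (Uq_gensP q)) rmorph1.
Qed.

Lemma starKV i : star (qU S) (UKV q i) = UKV q i.
Proof.
rewrite -[LHS]mulr1 -(Uq_KKV (Uq_gensP q) i) mulrA.
rewrite -[X in _ * X * _](Uq_starK (qU_hopf S) i) -starM.
by rewrite /UK /UKV (Uq_KKV (Uq_gensP q)) star1 mul1r.
Qed.

Lemma starF i : star (qU S) (UF q i) = UE q i.
Proof. by rewrite -(Uq_starE (qU_hopf S)) starK. Qed.

Lemma star_act_K a i :
  star (qA S) (act a (UK q i)) = act (star (qA S) a) (UKV q i).
Proof. by rewrite (act_star actP) (Uq_antipodeK (qU_hopf S)) starKV. Qed.

Lemma star_act_KV a i :
  star (qA S) (act a (UKV q i)) = act (star (qA S) a) (UK q i).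
Proof. by rewrite -[in RHS](act_KVK a i) star_act_K act_KVK. Qed.

Lemma star_act_E a i :
  star (qA S) (act a (UE q i)) = - q *: act (star (qA S) a) (UF q i).
Proof.
rewrite (act_star actP) (Uq_antipodeE (qU_hopf S)) star_linZ rmorphN /=.
by rewrite (CrealP (gtr0_real q_gt0)) (Uq_starE (qU_hopf S))
  (linZ (act_linr _)).
Qed.

Lemma star_act_F a i :
  star (qA S) (act a (UF q i)) = - q^-1 *: act (star (qA S) a) (UE q i).
Proof.
rewrite (act_star actP) (Uq_antipodeF (qU_hopf S)) star_linZ rmorphN fmorphV /=.
by rewrite (CrealP (gtr0_real q_gt0)) starF (linZ (act_linr _)).
Qed.

Lemma haar_act_K a b i : haar (a * act b (UK q i)) = haar (act a (UKV q i) * b).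
Proof.
rewrite -{1}(act_KVK a i) -act_M_K haar_act.
by rewrite (Uq_counitK (qU_hopf S)) mul1r.
Qed.

Lemma act_KEKV a i :
  act (act (act a (UK q i)) (UE q i)) (UKV q i) = q *: act a (UE q i).
Proof.
rewrite -!(act_aM actP) -(linZ (act_linr _)); congr (act _ _).
by rewrite /UK /UE /UKV mulrA (Uq_KE (Uq_gensP q)) -scalerAl -mulrA
  (Uq_KKV (Uq_gensP q)) mulr1.
Qed.

Lemma act_KFKV a i :
  act (act (act a (UK q i)) (UF q i)) (UKV q i) = q^-1 *: act a (UF q i).
Proof.
rewrite -!(act_aM actP) -(linZ (act_linr _)); congr (act _ _).
apply: (scalerI q_neq0); rewrite scalerA divff ?q_neq0//.
rewrite scale1r /UK /UF /UKV mulrA scalerAl -(Uq_FK (Uq_gensP q)) -mulrA.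
by rewrite (Uq_KKV (Uq_gensP q)) mulr1.
Qed.

Lemma haar_act_E a b i :
  haar (a * act b (UE q i)) = - q * haar (act a (UE q i) * b).
Proof.
(* The inserted K_i cancels the K_i^{-1} of Delta(E_i). Moving the other K_i off [b] conjugates E_i,
   and K_i E_i K_i^{-1} = q E_i gives the constant. *)
have := haar_act (act a (UK q i) * b) (UE q i).
rewrite (Uq_counitE (qU_hopf S)) mul0r act_M_E act_KKV linearD /= haar_act_K.
rewrite act_KEKV -scalerAl linearZ /= addrC => /eqP.
by rewrite addr_eq0 => /eqP ->; rewrite mulNr.
Qed.

Lemma haar_act_F a b i :
  haar (a * act b (UF q i)) = - q^-1 * haar (act a (UF q i) * b).
Proof.
have := haar_act (act a (UK q i) * b) (UF q i).
rewrite (Uq_counitF (qU_hopf S)) mul0r act_M_F act_KKV linearD /= haar_act_K.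
rewrite act_KFKV -scalerAl linearZ /= addrC => /eqP.
by rewrite addr_eq0 => /eqP ->; rewrite mulNr.
Qed.

(* With the given star structure the adjoint of E_i is q^2 F_i, not F_i: the
   scalar c absorbs the square of the antipode. *)
Definition adjoint_upto (c : C) (h k : U) := forall a b,
  haar (star (qA S) (act a h) * b) = c * haar (star (qA S) a * act b k).

Lemma adjointM c h k c' h' k' : adjoint_upto c h k -> adjoint_upto c' h' k' ->
  adjoint_upto (c' * c) (h * h') (k' * k).
Proof. by move=> hk hk' a b; rewrite !(act_aM actP) hk' hk mulrA. Qed.

Lemma adjointK i : adjoint_upto 1 (UK q i) (UK q i).
Proof. by move=> a b; rewrite mul1r star_act_K haar_act_K. Qed.

Lemma adjointE i : adjoint_upto (q ^+ 2) (UE q i) (UF q i).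
Proof.
move=> a b; rewrite star_act_E haar_act_F -scalerAl linearZ /= /GRing.scale /=.
by field; rewrite q_neq0.
Qed.

Lemma adjointF i : adjoint_upto (q ^- 2) (UF q i) (UE q i).
Proof.
move=> a b; rewrite star_act_F haar_act_E -scalerAl linearZ /= /GRing.scale /=.
by field; rewrite q_neq0.
Qed.

(** * Weights and the quantum su(2) of index i *)

Section Grading.
Variable i : 'I_2.

Definition weight (j : 'I_3) : int := (j == hi i)%:Z - (j == lo i)%:Z.

(** Combinations of words of length [n] and K_i-weight [m] in the u^j_k. The determinant relation
    equates words of different lengths, so an element may be graded for several [n]. *)
Inductive graded : nat -> int -> A -> Prop :=
  | graded0 n m : graded n m 0
  | gradedD n m a b : graded n m a -> graded n m b -> graded n m (a + b)
  | gradedZ n m c a : graded n m a -> graded n m (c *: a)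
  | graded1 : graded 0 0 1
  | graded_u n m j k a : graded n m a ->
      graded n.+1 (m + weight j) (Au q j k * a).

Lemma lo_hi : (lo i == hi i) = false.
Proof. by rewrite -val_eqE /= /bump /= add1n ltn_eqF. Qed.

Lemma weight_lo : weight (lo i) = -1.
Proof. by rewrite /weight lo_hi eqxx. Qed.

Lemma weight_hi : weight (hi i) = 1.
Proof. by rewrite /weight eqxx eq_sym lo_hi. Qed.

Lemma weight_ge j : -1 <= weight j.
Proof. by rewrite /weight; case: (_ == _); case: (_ == _). Qed.

(** Each of the [n] letters has weight at least -1. *)
Lemma graded_eq0 n m a : graded n m a -> m < - n%:Z -> a = 0.
Proof.
elim=> {n m a} [//|n m a b _ IHa _ IHb mn|n m c a _ IHa mn||n m j k a _ IHa mn].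
- by rewrite IHa// IHb// addr0.
- by rewrite IHa// scaler0.
- by rewrite oppr0 ltxx.
- by rewrite IHa ?mulr0//; have := weight_ge j; lia.
Qed.

(** Words grow on the left, so sums of graded elements are shown to be stable under left
    multiplication by every element, then this is applied to 1. *)
Lemma graded_span (P : A -> Prop) : (forall a b, P a -> P b -> P (a + b)) ->
  (forall n m a, graded n m a -> P a) -> forall a, P a.
Proof.
(* [Q b] says impredicatively that [b] is a finite sum of graded elements. *)
move=> PD PG a; pose Q b := forall P' : A -> Prop,
  (forall a b, P' a -> P' b -> P' (a + b)) ->
  (forall n m a, graded n m a -> P' a) -> P' b.
have Q1 : Q 1 by move=> P' _ PG'; apply: PG' graded1.
suff {P PD PG} : forall b, Q b -> Q (a * b).
  by move/(_ 1 Q1 P PD PG); rewrite mulr1.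
elim/presented_ind: a => [[j k]||c a IHa|a b IHa IHb|a b IHa IHb] d Qd.
- move=> P' PD' PG'; apply: (Qd (fun b => P' (Au q j k * b))) => [x y|n m x gx].
    by rewrite mulrDr; apply: PD'.
  exact: PG' (graded_u j k gx).
- by rewrite mul1r.
- move=> P' PD' PG'; rewrite -scalerAl.
  apply: (IHa d Qd (fun b => P' (c *: b))) => [x y|n m x gx].
    by rewrite scalerDr; apply: PD'.
  exact: PG' (gradedZ c gx).
- move=> P' PD' PG'; rewrite mulrDl; apply: (PD').
    exact: (IHa d Qd P' PD' PG').
  exact: (IHb d Qd P' PD' PG').
- by rewrite -mulrA; exact: IHa _ (IHb _ Qd).
Qed.

Lemma graded_act_K n m a : graded n m a ->
  act a (UK q i) = sqrtC q ^ m *: a.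
Proof.
elim=> {n m a} [n m|n m a b _ IHa _ IHb|n m c a _ IHa||n m j k a _ IHa].
- by rewrite (lin0 (act_linl _)) scaler0.
- by rewrite (linD (act_linl _)) IHa IHb scalerDr.
- by rewrite (linZ (act_linl _)) IHa !scalerA mulrC.
- by rewrite (act_1h actP) (Uq_counitK (qU_hopf S)) expr0z.
- rewrite act_M_K IHa (act_uK actP) -scalerAl -scalerAr scalerA mulrC.
  by rewrite -expfzDr ?sqrtq_neq0.
Qed.

Lemma graded_act_KV n m a : graded n m a ->
  act a (UKV q i) = sqrtC q ^ (- m) *: a.
Proof.
move=> g; rewrite -[in RHS](act_KKV a i) (graded_act_K g).
rewrite (linZ (act_linl _)) scalerA -expfzDr ?sqrtq_neq0// addNr.
by rewrite expr0z scale1r.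
Qed.

(** E_i turns a letter of weight 1 into one of weight -1 and keeps the word length; the bounded
    length plays the part of local finiteness. *)
Lemma graded_act_E n m a : graded n m a -> graded n (m - 2) (act a (UE q i)).
Proof.
elim=> {n m a} [n m|n m a b _ IHa _ IHb|n m c a _ IHa||n m j k a ga IHa].
- by rewrite (lin0 (act_linl _)); apply: graded0.
- by rewrite (linD (act_linl _)); apply: gradedD.
- by rewrite (linZ (act_linl _)); apply: gradedZ.
- rewrite (act_1h actP) (Uq_counitE (qU_hopf S)) scale0r; exact: graded0.
- rewrite act_M_E (act_uE actP) act_uKV (graded_act_K ga).
  rewrite -!scalerAl; apply: gradedD; last first.
    apply: gradedZ.
    by rewrite (_ : _ - 2 = m - 2 + weight j); [exact: graded_u|ring].
  have [->|_] := eqVneq j (hi i); last by rewrite scale0r; exact: graded0.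
  apply: gradedZ; rewrite weight_hi (_ : _ - 2 = m + weight (lo i)).
    by apply: graded_u; apply: gradedZ.
  by rewrite weight_lo; ring.
Qed.

Lemma graded_act_F n m a : graded n m a -> graded n (m + 2) (act a (UF q i)).
Proof.
elim=> {n m a} [n m|n m a b _ IHa _ IHb|n m c a _ IHa||n m j k a ga IHa].
- by rewrite (lin0 (act_linl _)); apply: graded0.
- by rewrite (linD (act_linl _)); apply: gradedD.
- by rewrite (linZ (act_linl _)); apply: gradedZ.
- rewrite (act_1h actP) (Uq_counitF (qU_hopf S)) scale0r; exact: graded0.
- rewrite act_M_F (act_uF actP) act_uKV (graded_act_K ga).
  rewrite -!scalerAl; apply: gradedD; last first.
    apply: gradedZ.
    by rewrite (_ : _ + 2 = m + 2 + weight j); [exact: graded_u|ring].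
  have [->|_] := eqVneq j (lo i); last by rewrite scale0r; exact: graded0.
  apply: gradedZ; rewrite weight_lo (_ : _ + 2 = m + weight (hi i)).
    by apply: graded_u; apply: gradedZ.
  by rewrite weight_hi; ring.
Qed.

(** The q-number [m], by which [E_i, F_i] acts in weight [m]. *)
Definition qint (m : int) : C := (q - q^-1)^-1 * (q ^ m - q ^ (- m)).

Lemma sqrt_exp m : sqrtC q ^ m * sqrtC q ^ m = q ^ m.
Proof. by rewrite -expfzMl -expr2 sqrtCK. Qed.

Lemma graded_act_EF n m a : graded n m a ->
  act (act a (UE q i)) (UF q i) = act (act a (UF q i)) (UE q i) + qint m *: a.
Proof.
move=> ga; rewrite -!(act_aM actP).
have -> : UE q i * UF q i = UF q i * UE q i +
    (q - q^-1)^-1 *: (UK q i ^+ 2 - UKV q i ^+ 2).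
  by rewrite -(Uq_EF (Uq_gensP q)) addrC subrK.
rewrite (linD (act_linr _)); congr (_ + _).
rewrite (linZ (act_linr _)) (linB (act_linr _)) !expr2 !(act_aM actP).
rewrite !(graded_act_K ga, graded_act_KV ga, linZ (act_linl _), scalerA).
by rewrite !sqrt_exp -scalerBl scalerA.
Qed.

Lemma qint_den_lt0 : q - q^-1 < 0.
Proof. by rewrite subr_lt0 (lt_trans q_lt1)// invf_gt1. Qed.

Lemma qint0 : qint 0 = 0.
Proof. by rewrite /qint oppr0 subrr mulr0. Qed.

Lemma qint_lt0 t : qint (- t.+1%:Z) < 0.
Proof.
rewrite /qint nmulr_rlt0 ?invr_lt0 ?qint_den_lt0// subr_gt0 opprK.
have qt : q ^+ t.+1 < 1 by rewrite exprn_ilt1// ltW.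
by rewrite -exprnN -exprnP (lt_trans qt)// invf_gt1// exprn_gt0.
Qed.

Lemma qint_le0 t : qint (- t%:Z) <= 0.
Proof. by case: t => [|t]; rewrite ?oppr0 ?qint0// ltW// qint_lt0. Qed.

Local Notation Fpow n := (iter n (act^~ (UF q i))).

Lemma Fpow_linear n : linear (Fpow n).
Proof.
by elim: n => [|n IHn] c a b //=; rewrite IHn act_linl.
Qed.

(** * Weight-zero functionals that vanish on the range of E_i *)

Section LowestWeight.
Variable phi : {linear A -> C^o}.
Hypothesis phiE : forall a, phi (act a (UE q i)) = 0.
Hypothesis phiKK : forall a, phi (act (act a (UK q i)) (UK q i)) = phi a.

(** K_i^2 acts by q^m, which differs from 1 since 0 < q < 1. *)
Lemma phi_graded_eq0 n m a : graded n m a -> m != 0 -> phi a = 0.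
Proof.
move=> ga m0; have := phiKK a.
rewrite (graded_act_K ga) (linZ (act_linl _)) (graded_act_K ga) scalerA.
rewrite sqrt_exp linearZ /= => /eqP.
rewrite -subr_eq0 -[X in _ - X]mul1r -mulrBl.
rewrite mulf_eq0 => /orP[|/eqP//].
by rewrite subr_eq0 pexprz_eq1 ?ltW// (negPf m0) lt_eqF.
Qed.

(** E_i is carried past the F_i one at a time, each exchange leaving a q-number; the last term is in
    the range of E_i and is killed by [phi]. For k = 0 the sum is empty, so [k.-1] is harmless. *)
Lemma phi_EF k n m a : graded n m a ->
  phi (Fpow k (act a (UE q i))) =
  (\sum_(j < k) qint (m + 2 * j%:Z)) * phi (Fpow k.-1 a).
Proof.
elim: k m a => [|k IHk] m a ga; first by rewrite big_ord0 mul0r phiE.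
rewrite iterSr (graded_act_EF ga) (linD (Fpow_linear k)) linearD /=.
rewrite (IHk _ _ (graded_act_F ga)) (linZ (Fpow_linear k)) linearZ /=.
rewrite big_ord_recl /= mulr0 addr0 mulrDl addrC; congr (_ + _).
case: k {IHk} => [|k]; first by rewrite !big_ord0 !mul0r.
rewrite -iterSr /=; congr (_ * _); apply: eq_bigr => j _; congr qint.
by rewrite /bump /=; lia.
Qed.

(* The coefficient relating [F^(j+1) a] to [F^(j+2) (E a)] is nonzero, and
   repeated application of [E] leaves the range of weights of words of length
   [n], so the induction terminates. *)
Lemma phi_F_lowest k n j a : graded n (- (2 * j.+1)%:Z) a ->
  (n < 2 * (j.+1 + k))%N -> phi (Fpow j.+1 a) = 0.
Proof.
elim: k j a => [|k IHk] j a ga nk.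
  have -> : a = 0 by apply: graded_eq0 ga _; lia.
  by rewrite (lin0 (Fpow_linear _)) linear0.
have gE : graded n (- (2 * j.+2)%:Z) (act a (UE q i)).
  rewrite (_ : - _ = - (2 * j.+1)%:Z - 2); last by lia.
  exact: graded_act_E.
have /eqP := IHk _ _ gE ltac:(lia).
rewrite (phi_EF _ ga) mulf_eq0 => /orP[|/eqP//].
(* Nothing cancels: the first q-number is negative, and the others have nonpositive arguments, so
   they are at most 0. *)
rewrite lt_eqF// big_ord_recl /= mulr0 addr0 -[ltRHS]addr0 ltr_leD//.
  exact: qint_lt0.
apply: sumr_le0 => t _; have tj : (t <= j)%N := ltn_ord t.
rewrite (_ : _ + _ = - (2 * (j - t))%N%:Z) ?qint_le0//.
by rewrite /bump /=; lia.
Qed.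

Lemma phi_act_F a : phi (act a (UF q i)) = 0.
Proof.
elim/graded_span: a => [a b|n m a ga].
  by rewrite (linD (act_linl _)) linearD /= => -> ->; rewrite addr0.
(* As a <| F_i has weight m + 2, only m = -2 remains, the case j = 0 of [phi_F_lowest]. *)
have [m2|] := eqVneq (m + 2) 0; last exact: phi_graded_eq0 (graded_act_F ga).
rewrite (_ : m = - (2 * 1)%N%:Z) in ga; last by lia.
by apply: (phi_F_lowest (k := n) ga); lia.
Qed.

(** Invariance passes from K_i^2 to K_i: in weight zero K_i acts as the identity, and in other
    weights [phi] vanishes. *)
Lemma phi_act_K a : phi (act a (UK q i)) = phi a.
Proof.
elim/graded_span: a => [a b|n m a ga].
  by rewrite (linD (act_linl _)) !linearD /= => -> ->.
rewrite (graded_act_K ga) linearZ /=; have [->|m0] := eqVneq m 0.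
  by rewrite expr0z scale1r.
by rewrite (phi_graded_eq0 ga m0) scaler0.
Qed.

End LowestWeight.
End Grading.

(** * Invariant functionals and the Peter-Weyl blocks *)

Lemma act_gen_invariant (phi : {linear A -> C^o}) :
  (forall a i, phi (act a (UK q i)) = phi a) ->
  (forall a i, phi (act a (UE q i)) = 0) ->
  (forall a i, phi (act a (UF q i)) = 0) ->
  forall h a, phi (act a h) = eps h * phi a.
Proof.
move=> pK pE pF h; elim/presented_ind: h =>
  [[i|i|i|i]||c h IHh|h k IHh IHk|h k IHh IHk] a.
- by rewrite (Uq_counitK (qU_hopf S)) mul1r; exact: pK.
- by rewrite (counitKV i) mul1r -(pK _ i) act_KVK.
- by rewrite (Uq_counitE (qU_hopf S)) mul0r; exact: pE.
- by rewrite (Uq_counitF (qU_hopf S)) mul0r; exact: pF.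
- by rewrite rmorph1 mul1r (act_a1 actP).
- by rewrite (linZ (act_linr _)) !linearZ /= IHh /GRing.scale /= mulrA.
- by rewrite (linD (act_linr _)) !linearD /= IHh IHk mulrDl.
- by rewrite (act_aM actP) rmorphM /= IHk IHh mulrCA mulrA.
Qed.

Lemma sqrtq_lt1 : sqrtC q < 1.
Proof. by rewrite -[ltRHS]sqrtC1 ltr_sqrtC ?nnegrE ?ltW. Qed.

Lemma act_K_exp a n i : act (a ^+ n) (UK q i) = act a (UK q i) ^+ n.
Proof.
elim: n => [|n IHn]; last by rewrite !exprS act_M_K IHn.
by rewrite !expr0 (act_1h actP) (Uq_counitK (qU_hopf S)) scale1r.
Qed.

Lemma act_star_u_K j k i : act (star (qA S) (Au q j k)) (UK q i) =
  sqrtC q ^ (- weight i j) *: star (qA S) (Au q j k).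
Proof.
rewrite -star_act_KV act_uKV star_linZ; congr (_ *: _).
have /CrealP sr := gtr0_real sqrtq_gt0.
by rewrite -[RHS](congr1 (fun s => s ^ (- weight i j)) sr) fmorphXz.
Qed.

Lemma act_hw_K1 n1 n2 :
  act (hw_vector S n1 n2) (UK q ord0) = sqrtC q ^+ n1 *: hw_vector S n1 n2.
Proof.
rewrite /hw_vector act_M_K !act_K_exp act_star_u_K (act_uK actP).
by rewrite expr0z scale1r exprZn -scalerAl.
Qed.

Lemma act_hw_K2 n1 n2 :
  act (hw_vector S n1 n2) (UK q ord_max) = sqrtC q ^+ n2 *: hw_vector S n1 n2.
Proof.
rewrite /hw_vector act_M_K !act_K_exp act_star_u_K (act_uK actP).
by rewrite expr0z scale1r exprZn -scalerAr.
Qed.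

Lemma coef_linear (f : {linear A -> C^o}) : linear (coef f).
Proof. exact: comul_sum_linear (coef_bilinear f). Qed.

Lemma PW_block_ind (P : A -> Prop) n1 n2 : submod_closed (mem (P : set A)) ->
  (forall v (f : {linear A -> C^o}), irrep S n1 n2 v -> P (coef f v)) ->
  forall a, PW_block S n1 n2 a -> P a.
Proof.
move=> Pc Pcoef a /(_ (P : set A)); apply; split=> //.
by move=> _ [v [f [vn ->]]]; exact: Pcoef.
Qed.

(** Invariance moves [h] out of a coefficient of hw <| h, leaving one of the highest weight vector.
    There some K_i scales by q^(n_i/2) < 1, while [phi] is K_i-invariant. *)
Lemma PW_block_gt0_eq0 (phi : {linear A -> C^o}) n1 n2 a :
  (forall h b, phi (act b h) = eps h * phi b) ->
  ~~ ((n1 == 0) && (n2 == 0))%N -> PW_block S n1 n2 a -> phi a = 0.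
Proof.
move=> phi_inv n_neq0.
apply: (PW_block_ind (P := fun a => phi a = 0)) => [|_ f [h _ <-]].
  split=> [|c u v]; rewrite !inE ?linear0// => pu pv.
  by rewrite linearP /= pu pv scaler0 addr0.
rewrite coef_act phi_inv.
suff -> : phi (coef f (hw_vector S n1 n2)) = 0 by rewrite mulr0.
have step i n : act (hw_vector S n1 n2) (UK q i) =
    sqrtC q ^+ n *: hw_vector S n1 n2 -> n != 0%N ->
    phi (coef f (hw_vector S n1 n2)) = 0.
  move=> hwK n0; have := phi_inv (UK q i) (coef f (hw_vector S n1 n2)).
  rewrite (Uq_counitK (qU_hopf S)) mul1r -coef_act hwK.
  rewrite (linZ (coef_linear f)) linearZ /= => /eqP.
  rewrite -subr_eq0 -[X in _ - X]mul1r -mulrBl mulf_eq0 => /orP[|/eqP//].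
  by rewrite subr_eq0 lt_eqF// exprn_ilt1 ?ltW ?sqrtq_gt0 ?sqrtq_lt1.
move: n_neq0; rewrite negb_and => /orP[]; apply: step.
  exact: act_hw_K1.
exact: act_hw_K2.
Qed.

Lemma PW_block00P a : PW_block S 0 0 a <-> exists c, a = c%:A.
Proof.
split.
  apply: (PW_block_ind (P := fun a => exists c, a = c%:A)) => [|_ f [h _ <-]].
    split=> [|c u v]; rewrite !inE.
      by exists 0; rewrite scale0r.
    by move=> [x ->] [y ->]; exists (c * x + y); rewrite scalerDl scalerA.
  rewrite /hw_vector !expr0 mulr1 coef_act.
  rewrite [coef _ _](comul_sum1 (qA S) (coef_bilinear f)).
  by rewrite (linZ (act_linl _)) (act_1h actP) scalerA; eexists.
move=> [c ->] M [Mc MG]; have [/[!inE] M0 M1] := Mc.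
rewrite -[_%:A]addr0; apply/set_mem/M1; rewrite inE//.
(* The Haar state serves as a linear form with value 1 at the unit. *)
apply: MG; exists 1, haar; split.
  exists 1 => //; rewrite /hw_vector !expr0 mulr1 (act_a1 actP)//.
rewrite -[RHS]/(comul_sum (qA S) (fun v w => (haar w : C) *: v) 1).
by rewrite (comul_sum1 (qA S) (coef_bilinear haar)) (haar1 (qhaar_state S))
  scale1r.
Qed.

Lemma PW_block0 n1 n2 : PW_block S n1 n2 0.
Proof. by move=> M [[/set_mem M0 _] _]. Qed.

(** * The Hilbert space completion *)

Section L2.
Variable L : L2_completion S.
Local Notation ip := (@L2ip _ _ _ L).
Local Notation of_ := (L2of L).

Lemma ip_linr x : linear (ip x : L2 L -> C^o). Proof. exact: L2ip_linear. Qed.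

Lemma ip_sym x y : ip x y = (ip y x)^*. Proof. exact: L2ip_sym. Qed.

Lemma ipZl c x y : ip (c *: x) y = c^* * ip x y.
Proof. by rewrite ip_sym (linZ (ip_linr _)) rmorphM /= -ip_sym. Qed.

Lemma ipBl x y z : ip (x - y) z = ip x z - ip y z.
Proof. by rewrite ip_sym (linB (ip_linr _)) rmorphB /= -!ip_sym. Qed.

Lemma Cauchy_Schwarz x y : `|ip x y| <= `|x| * `|y|.
Proof.
rewrite -ler_sqr ?nnegrE ?mulr_ge0// exprMn.
have [->|y0] := eqVneq y 0.
  by rewrite (lin0 (ip_linr _)) !normr0 !expr0n mulr0.
set N := `|y| ^+ 2; have N0 : 0 < N by rewrite exprn_gt0 ?normr_gt0.
(* |y|^2 times the component of [x] orthogonal to [y], which avoids a division. *)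
pose w := N *: x - ip y x *: y.
have wy : ip w y = 0.
  rewrite ip_sym (linB (ip_linr _)) !(linZ (ip_linr _)) L2ip_norm -/N.
  by rewrite /GRing.scale /= mulrC subrr conjC0.
have := exprn_ge0 2 (normr_ge0 w).
rewrite -L2ip_norm {2}/w (linB (ip_linr _)) !(linZ (ip_linr _)) wy scaler0.
rewrite subr0.
rewrite pmulr_rge0// ipBl !ipZl L2ip_norm -(ip_sym x y) (CrealP (gtr0_real N0)).
by rewrite (ip_sym y x) mulrC -normCK subr_ge0 mulrC.
Qed.

Lemma ip_cvg x (u : nat -> L2 L) y : u @ \oo --> y ->
  (fun n => ip x (u n) : C^o) @ \oo --> (ip x y : C^o).
Proof.
move=> uy; apply/cvgrPdist_lt => e e0.
have x1 : 0 < `|x| + 1 by rewrite ltr_wpDl.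
have : 0 < e / (`|x| + 1) by rewrite divr_gt0.
move: uy => /cvgrPdist_lt /[apply]; apply: filterS => n.
rewrite ltr_pdivlMr// mulrC; apply: le_lt_trans.
rewrite -(linB (ip_linr x)) (le_trans (Cauchy_Schwarz _ _))//.
by rewrite ler_wpM2r// lerDl.
Qed.

(** For nonzero y, density gives [a] with |y - a| < |y|, yet |y|^2 = <y, y - a> is at most |y| |y -
    a|. *)
Lemma ip_dense_eq0 y : (forall a, ip (of_ a) y = 0) -> y = 0.
Proof.
move=> ay; apply/eqP/negPn/negP => y0.
have [z [/= yz [a _ az]]] : (ball y `|y| `&` range of_) !=set0.
  apply: (@L2_dense _ _ _ L (ball y `|y|)); last exact: ball_open.
  by exists y; apply: ballxx; rewrite normr_gt0.
move: yz; rewrite -{}az -ball_normE /= => ya.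
have : `|ip y (y - of_ a)| < `|y| ^+ 2.
  apply: le_lt_trans (Cauchy_Schwarz _ _) _.
  by rewrite expr2 ltr_pM2l ?normr_gt0.
rewrite (linB (ip_linr _)) (ip_sym y (of_ a)) ay conjC0 subr0 L2ip_norm.
by rewrite normrX normr_id ltxx.
Qed.

(** * Peter-Weyl expansions and the blockwise action *)

Definition partial (b : nat -> nat -> A) (N : nat) : L2 L :=
  \sum_(n1 < N) \sum_(n2 < N) of_ (b n1 n2).

Lemma ip_partial x b N : ip x (partial b N) =
  \sum_(n1 < N) \sum_(n2 < N) ip x (of_ (b n1 n2)).
Proof.
rewrite (lin_sum (ip_linr x)); apply: eq_bigr => n1 _.
exact: (lin_sum (ip_linr x)).
Qed.

(** Adjointness holds on partial sums and passes to the limit by continuity of the inner product. *)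
Lemma L2_act_weak c h k x y a : adjoint_upto c h k -> L2_act x k y ->
  ip (of_ (act a h)) x = c * ip (of_ a) y.
Proof.
move=> hk [b [[_ bx] [_ by_]]].
have cx := ip_cvg (x := of_ (act a h)) bx.
have cy : (fun N => c * ip (of_ a) (partial (fun n1 n2 => act (b n1 n2) k) N)
    : C^o) @ \oo --> (c * ip (of_ a) y : C^o).
  by apply: cvgM; [exact: cvg_cst|exact: ip_cvg by_].
suff E N : ip (of_ (act a h)) (partial b N) =
    c * ip (of_ a) (partial (fun n1 n2 => act (b n1 n2) k) N).
  by move: cx; rewrite (funext E) => cx; exact: norm_cvg_unique cx cy.
rewrite !ip_partial mulr_sumr; apply: eq_bigr => n1 _; rewrite mulr_sumr.
by apply: eq_bigr => n2 _; rewrite !L2ip_haar hk.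
Qed.

Definition pairing (x : L2 L) (a : A) : C^o := ip x (of_ a).

Lemma pairing_linear x : linear (pairing x).
Proof. by move=> c a b; rewrite /pairing linearP ip_linr. Qed.

HB.instance Definition _ x :=
  GRing.isLinear.Build C A C^o *:%R (pairing x) (pairing_linear x).

Lemma pairing1 a : pairing (of_ 1) a = haar a.
Proof. by rewrite /pairing L2ip_haar star1 mul1r. Qed.

Lemma pairing_act c h k l x a : adjoint_upto c h k ->
  L2_act x k (l *: x) -> pairing x (act a h) = (c * l)^* * pairing x a.
Proof.
move=> hk /(L2_act_weak a hk); rewrite (linZ (ip_linr _)).
move=> E.
by rewrite /pairing ip_sym E (ip_sym x (of_ a)) -rmorphM -mulrA.
Qed.

Lemma ord2E (i : 'I_2) : i = ord0 \/ i = ord_max.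
Proof. by case: i => -[|[|//]] ?; [left|right]; apply: val_inj. Qed.

(** Adjoints exchange E_i and F_i, so x <| F_i = 0 makes the pairing vanish on the range of E_i, and
    conversely. *)
Lemma pairing_invariant x : L2_CP2 x -> L2_act x (UF q ord_max) 0 ->
  forall h a, pairing x (act a h) = eps h * pairing x a.
Proof.
move=> xCP2 xF.
have inv c h k a : adjoint_upto c h k -> @Uq_u2 _ q k ->
    pairing x (act a h) = (c * eps k)^* * pairing x a.
  by move=> hk /xCP2; apply: pairing_act.
have K1 a : pairing x (act a (UK q ord0)) = pairing x a.
  rewrite (inv _ _ _ _ (adjointK ord0)); last first.
    by apply: sub_gen_smallest; left.
  by rewrite (Uq_counitK (qU_hopf S)) mulr1 conjC1 mul1r.
have E1 a : pairing x (act a (UE q ord0)) = 0.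
  rewrite (inv _ _ _ _ (adjointE ord0)); last first.
    by apply: sub_gen_smallest; right; right; right; left.
  by rewrite (Uq_counitF (qU_hopf S)) mulr0 conjC0 mul0r.
have F1 a : pairing x (act a (UF q ord0)) = 0.
  rewrite (inv _ _ _ _ (adjointF ord0)); last first.
    by apply: sub_gen_smallest; right; right; left.
  by rewrite (Uq_counitE (qU_hopf S)) mulr0 conjC0 mul0r.
have E2 a : pairing x (act a (UE q ord_max)) = 0.
  rewrite (pairing_act (l := 0) a (adjointE ord_max)).
    by rewrite mulr0 conjC0 mul0r.
  by rewrite scale0r.
have KK a : pairing x (act (act a (UK q ord_max)) (UK q ord_max)) = pairing x a.
  have K2 := adjointK ord_max.
  (* K_2^2 enters through the generator K_1 K_2^2 of U_q(u(2)); [K1] then removes K_1. *)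
  have := inv _ _ _ a (adjointM (adjointM K2 K2) (adjointK ord0)).
  rewrite !mul1r !(act_aM actP) K1 => ->.
    by rewrite !rmorphM /= !(Uq_counitK (qU_hopf S)) conjC1 !mul1r.
  by apply: sub_gen_smallest; right; right; right; right; left; rewrite expr2.
apply: act_gen_invariant => a i; have [->|->] := ord2E i.
- exact: K1.
- exact: phi_act_K KK a.
- exact: E1.
- exact: E2.
- exact: F1.
- exact: phi_act_F E2 KK a.
Qed.

(** [pairing w] kills every block but (0,0), so the pairings with the partial sums are constant from
    N = 1 on; at N = 0 the sum is empty. *)
Lemma ip_expansion w x b :
  (forall h a, pairing w (act a h) = eps h * pairing w a) ->
  PW_expansion x b -> ip w x = ip w (of_ (b 0 0)%N).
Proof.
move=> w_inv [bB bx]; have cx := ip_cvg (x := w) bx.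
apply: (norm_cvg_unique cx).
apply: cvg_near_cst; exists 1%N => // -[//|N] _ /=.
rewrite -[LHS]/(ip _ (partial _ _)) ip_partial.
have z n1 n2 : ~~ ((n1 == 0) && (n2 == 0))%N -> ip w (of_ (b n1 n2)) = 0.
  move=> n0.
  exact: (PW_block_gt0_eq0 (phi := pairing w) w_inv n0 (bB n1 n2)).
rewrite !big_ord_recl /= !big1 ?addr0// => n1 _; last exact: z.
by rewrite big1// => n2 _; exact: z.
Qed.

(** The pairings with x and with 1 are both invariant, so x - c 1 is orthogonal to x and to 1, hence
    to itself. *)
Lemma CP2_kernel_scalar x : L2_CP2 x -> L2_act x (UF q ord_max) 0 ->
  exists c, x = c *: of_ 1.
Proof.
move=> xCP2 xF; have x_inv := pairing_invariant xCP2 xF.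
have one_inv h a : pairing (of_ 1) (act a h) = eps h * pairing (of_ 1) a.
  by rewrite !pairing1 haar_act.
have [b [xb _]] := xF; have [c bc] := (PW_block00P _).1 (xb.1 0%N 0%N).
exists c; have E w : (forall h a, pairing w (act a h) = eps h * pairing w a) ->
    ip w (x - c *: of_ 1) = 0.
  move=> w_inv; rewrite (linB (ip_linr _)) (ip_expansion w_inv xb) bc.
  by rewrite linearZ subrr.
apply/eqP; rewrite -subr_eq0 -normr_eq0 -sqrf_eq0 -L2ip_norm.
by rewrite {1}ipBl ipZl !E// mulr0 subr0.
Qed.

(** * Multiples of the unit, and the kernel of [Z] *)

Definition unit_block (c : C) (n1 n2 : nat) : A :=
  if ((n1 == 0) && (n2 == 0))%N then c%:A else 0.

Lemma unit_expansion c : PW_expansion (c *: of_ 1) (unit_block c).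
Proof.
split=> [n1 n2|].
  rewrite /unit_block; case: ifPn => [/andP[/eqP-> /eqP->]|_].
    by apply/PW_block00P; exists c.
  exact: PW_block0.
apply: cvg_near_cst; exists 1%N => // -[//|N] _ /=.
rewrite !big_ord_recl /= !big1 ?addr0 => [|n1 _|n1 _].
- by rewrite linearZ.
- by rewrite big1// => n2 _; rewrite /unit_block /= linear0.
- by rewrite /unit_block /= linear0.
Qed.

Lemma unit_L2_act c h : L2_act (c *: of_ 1) h ((eps h : C) *: (c *: of_ 1)).
Proof.
exists (unit_block c); split; first exact: unit_expansion.
rewrite scalerA (_ : (fun _ _ => _) = unit_block (eps h * c)).
  exact: unit_expansion.
apply/funext => n1; apply/funext => n2; rewrite /unit_block; case: ifP => _.
  by rewrite (linZ (act_linl _)) (act_1h actP) scalerA mulrC.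
exact: lin0 (act_linl _).
Qed.

(** [Z] picks its values by choice, so every candidate [y] must be shown to vanish: it is orthogonal
    to the dense algebra because haar(a <| h) = 0. *)
Lemma unit_L2_act_eq0 d h k c y : adjoint_upto d h k -> d != 0 -> eps h = 0 ->
  L2_act (c *: of_ 1) k y -> y = 0.
Proof.
move=> hk d0 h0 /L2_act_weak-/(_ _ _ _ hk) E; apply: ip_dense_eq0 => a.
apply: (mulfI d0); rewrite mulr0 -E (linZ (ip_linr _)) ip_sym.
by rewrite -/(pairing _ _) pairing1 haar_act h0 mul0r conjC0 scaler0.
Qed.

Lemma kernel_Z_CP2 :
  [set x : L2 L | L2_CP2 x /\ Z_dom x /\ Z x = (0, 0)] =
  [set c *: of_ 1 | c in [set: C]].
Proof.
apply/seteqP; split=> [x [xCP2 [[_ xF] [_ ZF]]]|_ [c _ <-]] /=.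
  (* Membership in [Z_dom] makes the chosen value, here 0, a genuine blockwise image. *)
  have := xgetPex 0 xF; rewrite ZF => /(CP2_kernel_scalar xCP2)[c ->].
  by exists c.
split; first by move=> h _; exact: unit_L2_act.
split; first by split; eexists; exact: unit_L2_act.
have q0 := q_neq0.
have EF := adjointE.
(* [xget] returns a blockwise image or the default 0; only the former needs an argument. *)
congr (_, _); case: xgetP => // y _.
  apply: (unit_L2_act_eq0 (adjointM (EF ord0) (EF ord_max))).
    by rewrite mulf_neq0// expf_neq0.
  by rewrite rmorphM /= !(Uq_counitE (qU_hopf S)) mul0r.
apply: (unit_L2_act_eq0 (EF ord_max)); first by rewrite expf_neq0.
by rewrite (Uq_counitE (qU_hopf S)).
Qed.

End L2.
End QuantumGroup.

Local Open Scope complex_scope.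

Theorem proposition5p1 (R : realType) (q : R) (hq : 0 < q < 1)
    (S : quantum_SU3 q%:C) (L : L2_completion S) :
  [set x : L2 L | L2_CP2 x /\ Z_dom x /\ Z x = (0, 0)] =
  [set c *: L2of L 1 | c in [set: R[i]]].
Proof.
case/andP: hq => q_gt0 q_lt1.
by apply: kernel_Z_CP2; rewrite (ltcR 0 q, ltcR q 1).
Qed.
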